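(* Let $n\geq 3$. If $n$ is odd, then $\{g,g_n^2\}$ is a generating set of the monoid $\mathcal{AOP}_n$ with minimum size. If $n$ is even, then $\{g^2,g_1,g_n\}$ is a generating set of the monoid $\mathcal{AOP}_n$ with minimum size. In particular, $\mathcal{AOP}_n$ has rank $2$ if $n$ is odd, and $\mathcal{AOP}_n$ has rank $3$ if $n$ is even.
   Context: Let $\Omega_n=\{1<2<\cdots<n\}$ and let $\mathcal{I}_n$ be the symmetric inverse monoid on $\Omega_n$ (all injective partial maps of $\Omega_n$), with maps written on the right and composed left to right. The alternating inverse monoid is $\mathcal{AI}_n=\{\alpha\in\mathcal{I}_n : \alpha=\sigma|_{\mathrm{Dom}(\alpha)}\text{ for some even permutation }\sigma\text{ of }\Omega_n\}$. A partial permutation $\alpha$ with $\mathrm{Dom}(\alpha)=\{a_1<\cdots<a_t\}$, $t\geq 0$, is orientation-preserving if there is at most one index $i\in\{1,\ldots,t\}$ with $a_i\alpha>a_{i+1}\alpha$, where $a_{t+1}$ denotes $a_1$. $\mathcal{AOP}_n$ is the submonoid of all orientation-preserving elements of $\mathcal{AI}_n$. Let $g=(1\,2\,\cdots\,n)$ be the $n$-cycle $1\mapsto2\mapsto\cdots\mapsto n\mapsto1$; let $g_n$ be the partial permutation with domain and image $\{1,\ldots,n-1\}$ given by $1\mapsto2\mapsto\cdots\mapsto n-1\mapsto1$; let $g_1$ be the partial permutation with domain and image $\{2,\ldots,n\}$ given by $2\mapsto3\mapsto\cdots\mapsto n\mapsto2$. The rank of a finite monoid is the minimum size of a generating set (as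 a monoid). *)

(* Defs.v *)
From HB Require Import structures.
From mathcomp Require Import all_boot all_fingroup.

Set Implicit Arguments.
Unset Strict Implicit.
Unset Printing Implicit Defensive.

(* The chain 1 < ... < n is represented by 'I_n, i.e. 0 < ... < n - 1; a partial
   map is undefined where it takes the value None. *)
Definition pinjective n (f : {ffun 'I_n -> option 'I_n}) : bool :=
  [forall x, forall y, isSome (f x) && (f x == f y) ==> (x == y)].

Record pperm n := PPerm {
  pperm_fun :> {ffun 'I_n -> option 'I_n};
  pperm_inj : pinjective pperm_fun }.

HB.instance Definition _ n := [isSub for @pperm_fun n].
HB.instance Definition _ n := [Finite of pperm n by <:].

Lemma pinjectiveP n (f : {ffun 'I_n -> option 'I_n}) :
  reflect (forall x y z, f x = Some z -> f y = Some z -> x = y) (pinjective f).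
Proof.
apply: (iffP forallP) => [inj_f x y z fx fy | inj_f x].
  by have /forallP/(_ y) := inj_f x; rewrite fx fy eqxx /= => /eqP.
apply/forallP => y; apply/implyP; case fx: (f x) => [z|] //= /eqP fy.
by apply/eqP/(inj_f _ _ z).
Qed.

Section PpermMonoid.
Variable n : nat.
Implicit Types a b c : pperm n.

Lemma pperm1_subproof : pinjective [ffun x : 'I_n => Some x].
Proof. by apply/pinjectiveP => x y z; rewrite !ffunE => -[->] [->]. Qed.
Definition pperm1 := PPerm pperm1_subproof.

Lemma pperm_mul_subproof a b : pinjective [ffun x => obind b (a x)].
Proof.
apply/pinjectiveP => x y z; rewrite !ffunE.
case ax: (a x) => [u|] //= bu; case ay: (a y) => [v|] //= bv.
have uv := pinjectiveP _ (pperm_inj b) _ _ _ bu bv.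
by rewrite -uv in ay; apply: (pinjectiveP _ (pperm_inj a)) ax ay.
Qed.
(* Maps act on the right: a is applied first. *)
Definition pperm_mul a b := PPerm (pperm_mul_subproof a b).

Lemma pperm_mulA : associative pperm_mul.
Proof.
move=> a b c; apply/val_inj/ffunP => x; rewrite !ffunE /=.
by case: (a x) => //= y; rewrite ffunE.
Qed.
Lemma pperm_1mul : left_id pperm1 pperm_mul.
Proof. by move=> a; apply/val_inj/ffunP => x; rewrite !ffunE. Qed.
Lemma pperm_mul1 : right_id pperm1 pperm_mul.
Proof.
move=> a; apply/val_inj/ffunP => x; rewrite !ffunE /=.
by case: (a x) => //= y; rewrite ffunE.
Qed.

HB.instance Definition _ :=
  isMonoid.Build (pperm n) pperm_mulA pperm_1mul pperm_mul1.

End PpermMonoid.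

Section Rank.
Variable n : nat.
Implicit Types S A B : {set pperm n}.

Definition is_submonoid S : bool :=
  (1%g \in S) && [forall x in S, forall y in S, (x * y)%g \in S].

Definition gen_submonoid A : {set pperm n} :=
  \bigcap_(S : {set pperm n} | is_submonoid S && (A \subset S)) S.

Definition generates S A : bool := gen_submonoid A == S.

Definition min_generating S A : Prop :=
  generates S A /\ forall B, generates S B -> #|A| <= #|B|.

(* A submonoid S generates itself, so the default S of the arg min below
   satisfies the constraint. *)
Definition mrank S : nat := #|[arg min_(A < S | generates S A) #|A|]|.

End Rank.

Section AOP.
Variable n : nat.
Implicit Type a : pperm n.

Definition pdom a : {set 'I_n} := [set x | isSome (a x)].

Definition alternating a : bool :=
  [exists s : {perm 'I_n}, ~~ odd_perm s &&
     [forall x in pdom a, a x == Some (s x)]].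

(* The images a_1 a, ..., a_t a, where a_1 < ... < a_t is the domain of a. *)
Definition image_seq a : seq nat := [seq val y | y <- pmap a (enum 'I_n)].

(* ordS is the cyclic successor, so that the index after the last is the first. *)
Definition orientation_preserving a : bool :=
  let s := image_seq a in
  #|[set i : 'I_(size s) | nth 0 s (ordS i) < nth 0 s i]| <= 1.

Definition AI : {set pperm n} := [set a | alternating a].
Definition AOP : {set pperm n} := [set a in AI | orientation_preserving a].

End AOP.

(* In the 0-based convention: g is x |-> x + 1 mod n; g_n fixes {0, ..., n - 2}
   setwise and is undefined at n - 1; g_1 fixes {1, ..., n - 1} setwise and is
   undefined at 0.  Every argument of insub is less than n, so insub
   returns Some. *)
Section Generators.
Variable n : nat.

Definition cyc_fun : {ffun 'I_n -> option 'I_n} :=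
  [ffun x : 'I_n => insub (x.+1 %% n)].

Definition cyc_last_fun : {ffun 'I_n -> option 'I_n} :=
  [ffun x : 'I_n => if x < n.-1 then insub (x.+1 %% n.-1) else None].

Definition cyc_first_fun : {ffun 'I_n -> option 'I_n} :=
  [ffun x : 'I_n =>
     if 0 < x then insub (if x.+1 < n then x.+1 else 1) else None].

Lemma modS_inj m x y : x < m -> y < m -> x.+1 = y.+1 %[mod m] -> x = y.
Proof.
move=> xm ym /eqP; rewrite -(addn1 x) -(addn1 y) eqn_modDr => /eqP.
by rewrite !modn_small.
Qed.

Lemma insub_ord_inj i j (z : 'I_n) : insub i = Some z -> insub j = Some z -> i = j.
Proof. by case: insubP => // u _ <- [->]; case: insubP => // v _ <- [->]. Qed.

Lemma cyc_subproof : pinjective cyc_fun.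
Proof.
apply/pinjectiveP => x y z; rewrite !ffunE => fx fy; apply/val_inj.
exact: modS_inj (ltn_ord x) (ltn_ord y) (insub_ord_inj fx fy).
Qed.

Lemma cyc_last_subproof : pinjective cyc_last_fun.
Proof.
apply/pinjectiveP => x y z; rewrite !ffunE.
case: ifP => // xn fx; case: ifP => // yn fy; apply/val_inj.
exact: modS_inj xn yn (insub_ord_inj fx fy).
Qed.

Lemma cyc_first_subproof : pinjective cyc_first_fun.
Proof.
apply/pinjectiveP => x y z; rewrite !ffunE.
case: ifP => // x0 fx; case: ifP => // y0 fy; apply/val_inj.
have := insub_ord_inj fx fy; case: (ltnP x.+1 n) (ltn_ord x) => nx xn;
  case: (ltnP y.+1 n) (ltn_ord y) => ny yn /=.
- by case.
- by case=> x0'; rewrite x0' in x0.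
- by case=> y0'; rewrite -y0' in y0.
- by move=> _; apply: succn_inj; apply/eqP; rewrite eqn_leq (leq_trans xn) ?(leq_trans yn).
Qed.

Definition g_cyc : pperm n := PPerm cyc_subproof.
Definition g_last : pperm n := PPerm cyc_last_subproof.
Definition g_first : pperm n := PPerm cyc_first_subproof.

End Generators.

(* Main.v *)
Require Import Defs.
From mathcomp Require Import all_boot all_fingroup all_algebra ring zify.

Set Implicit Arguments.
Unset Strict Implicit.
Unset Printing Implicit Defensive.
Import GRing.Theory.

(* An element of AOP_n is a restriction [res s A] of an even permutation s that
   preserves the cyclic order on A.  The image of A under s is a set of points on the
   n-gon, and s can be undone by elementary moves: rotate everything, or let the point
   next to a hole jump into it (the transposition [tau p]).

   The generated monoid M is closed under inverses and restrictions, contains the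
   squared rotation, and contains the 3-cycles [tri p], which carry a hole over two
   points.  When there are two holes, the second one can be brought next to a given
   one by such 3-cycles, which yields every single jump [tau p]; so all elements of
   corank at least 2 are in M.  When there is at most one hole, s is determined by its
   restriction and the parity of s counts the odd moves (jumps, and rotations if n is
   even), so that these can be paired off inside M.

   For the lower bound, the total elements form a submonoid, and so do the partial
   ones together with 1; hence a total and a partial generator are needed.  If n is
   even, total elements preserve the parity of points, and the elements of corank 1
   missing an odd, respectively even, point need one generator each. *)

(** * Restrictions of permutations *)

Section Restriction.
Variable n : nat.
Implicit Types (s t : {perm 'I_n}) (A B : {set 'I_n}).

Lemma res_subproof s A : pinjective [ffun x => if x \in A then Some (s x) else None].
Proof.
apply/pinjectiveP => x y z; rewrite !ffunE.
by case: ifP => // _ [<-]; case: ifP => // _ [/perm_inj].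
Qed.
Definition res s A : pperm n := PPerm (res_subproof s A).

Lemma resE s A x : res s A x = if x \in A then Some (s x) else None.
Proof. by rewrite ffunE. Qed.

Lemma pperm_eqP (a b : pperm n) : (forall x, a x = b x) -> a = b.
Proof. by move=> ab; apply/val_inj/ffunP. Qed.

Lemma ppermM (a b : pperm n) x : (a * b)%g x = obind b (a x).
Proof. by rewrite ffunE. Qed.

Lemma pperm1E x : (1%g : pperm n) x = Some x.
Proof. by rewrite ffunE. Qed.

Lemma eq_res s t A : (forall x : 'I_n, x \in A -> s x = t x) -> res s A = res t A.
Proof. by move=> st; apply: pperm_eqP => x; rewrite !resE; case: ifP => // /st ->. Qed.

Lemma res1T : res 1%g setT = 1%g.
Proof. by apply: pperm_eqP => x; rewrite resE pperm1E inE perm1. Qed.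

Lemma resM s t A B : (res s A * res t B)%g = res (s * t)%g (A :&: s @^-1: B).
Proof.
apply: pperm_eqP => x; rewrite ppermM !resE !inE permM.
by case: (x \in A) => //=; rewrite resE.
Qed.

Lemma pdom_res s A : pdom (res s A) = A.
Proof. by apply/setP => x; rewrite inE resE; case: (x \in A). Qed.

Lemma alternatingP (a : pperm n) :
  reflect (exists2 s, ~~ odd_perm s & a = res s (pdom a)) (alternating a).
Proof.
apply: (iffP existsP) => [[s /andP[ev /forall_inP as_]]|[s ev as_]]; exists s => //.
  apply: pperm_eqP => x; rewrite resE; case: ifP => [/as_/eqP//|].
  by rewrite inE; case: (a x).
by rewrite ev; apply/forall_inP => x xa; rewrite as_ resE xa.
Qed.

(** The exponent is a successor because the zeroth power of [res s A] is the identity on all points,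
    not only on [A]. *)
Lemma res_stable_exp s A k : s @: A = A -> (res s A ^+ k.+1)%g = res (s ^+ k.+1)%g A.
Proof.
move=> sA; elim: k => [|k IH]; first by rewrite !expg1.
rewrite expgS IH resM -expgS; congr res; apply/setP => x; rewrite !inE.
by rewrite -{2}sA (mem_imset _ _ perm_inj) andbb.
Qed.

End Restriction.

(** * Generated submonoids *)

Section Submonoid.
Variable n : nat.
Implicit Types (M A S B : {set pperm n}).

Lemma is_submonoidP S :
  reflect (1%g \in S /\ (forall a b, a \in S -> b \in S -> (a * b)%g \in S))
          (is_submonoid S).
Proof.
apply: (iffP andP) => -[S1 Sm]; split=> //.
  by move=> a b aS bS; have /forall_inP/(_ a aS)/forall_inP := Sm; apply.
by apply/forall_inP => a aS; apply/forall_inP => b bS; apply: Sm.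
Qed.

Lemma gen_submonoid_is A : is_submonoid (gen_submonoid A).
Proof.
apply/is_submonoidP; split; first by apply/bigcapP => S /andP[/is_submonoidP[]].
move=> a b /bigcapP aA /bigcapP bA; apply/bigcapP => S SA.
by have /andP[/is_submonoidP[_ Sm] _] := SA; rewrite Sm ?aA ?bA.
Qed.

Lemma sub_gen_submonoid A : A \subset gen_submonoid A.
Proof. by apply/bigcapsP => S /andP[]. Qed.

Lemma gen_submonoid_sub A S :
  is_submonoid S -> A \subset S -> gen_submonoid A \subset S.
Proof. by move=> Sm AS; apply: bigcap_inf; rewrite Sm. Qed.

Lemma submonoid_exp S a k : is_submonoid S -> a \in S -> (a ^+ k)%g \in S.
Proof.
by case/is_submonoidP=> S1 Sm aS; elim: k => // k IH; rewrite expgS Sm.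
Qed.

Lemma generates_self S : is_submonoid S -> generates S S.
Proof.
by move=> Sm; rewrite /generates eqEsubset gen_submonoid_sub ?sub_gen_submonoid.
Qed.

Lemma mrank_min S A : is_submonoid S -> min_generating S A -> mrank S = #|A|.
Proof.
move=> Sm [gA minA]; rewrite /mrank.
case: arg_minnP; first exact: generates_self.
by move=> B gB minB; apply/eqP; rewrite eqn_leq minA ?minB.
Qed.

(** The source of every lower bound: a generating set inside a submonoid [T] generates nothing
    outside [T]. *)
Lemma generates_notin S T B a :
  generates S B -> is_submonoid T -> a \in S -> a \notin T ->
  exists2 b, b \in B & b \notin T.
Proof.
move=> /eqP gB Tm aS aT; apply/exists_inP; apply: contraR aT => /exists_inPn noB.
rewrite -gB in aS; apply: (subsetP (gen_submonoid_sub Tm _)) aS.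
by apply/subsetP => b /noB; rewrite negbK.
Qed.

End Submonoid.

(** * Inverses inside a generated submonoid *)

Section InverseClosed.
Variables (n : nat) (M : {set pperm n}).
Implicit Types (s t : {perm 'I_n}) (A B : {set 'I_n}).
Hypothesis Mm : is_submonoid M.

Lemma resM_in s t A B :
  res s A \in M -> res t B \in M -> (forall x : 'I_n, x \in A -> s x \in B) ->
  res (s * t)%g A \in M.
Proof.
move=> sM tM sAB; have /is_submonoidP[_ /(_ _ _ sM tM)] := Mm; rewrite resM.
congr (res _ _ \in M); apply/setP => x; rewrite !inE.
by case xA: (x \in A) => //=; rewrite sAB.
Qed.

Lemma res_stable_inv s A : s @: A = A -> res s A \in M -> res s^-1%g A \in M.
Proof.
move=> sA sM; have s0 := order_gt0 s.
(* The order is doubled so that the exponent, one less, is positive even for [s = 1]. *)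
have -> : s^-1%g = (s ^+ (#[s]%g * 2).-1.-1.+1)%g.
  rewrite prednK; last by case: #[s]%g s0 => [|[|k]].
  by apply/eqP; rewrite eq_invg_mul -expgS prednK ?muln_gt0 ?s0 // expgM expg_order expg1n.
by rewrite -res_stable_exp // submonoid_exp.
Qed.

End InverseClosed.

(** Each generator permutes its domain, so its inverse is one of its powers. The elements of the
    generated monoid that have an inverse partial map in it form a submonoid containing [G]. *)
Lemma gen_inverse_closed n (G : {set pperm n}) (s : {perm 'I_n}) A :
  {in G, forall a, exists t B, a = res t B /\ t @: B = B} ->
  res s A \in gen_submonoid G -> res s^-1%g (s @: A) \in gen_submonoid G.
Proof.
set M := gen_submonoid G => Gst sM; have Mm : is_submonoid M := gen_submonoid_is G.
have M1 := proj1 (is_submonoidP _ Mm); have Mmul := proj2 (is_submonoidP _ Mm).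
pose inv (a b : pperm n) := [forall x, forall y, (a x == Some y) == (b y == Some x)].
have invP (a b : pperm n) : reflect (forall x y, a x = Some y <-> b y = Some x) (inv a b).
  apply: (iffP forallP) => [ab x y|ab x].
    by have /forallP/(_ y)/eqP ab' := ab x; split=> /eqP; [rewrite ab'|rewrite -ab'] => /eqP.
  by apply/forallP => y; apply/eqP; apply/idP/idP => /eqP/ab/eqP.
pose S := [set a in M | [exists b in M, inv a b]].
have Sm : is_submonoid S.
  apply/is_submonoidP; split.
    rewrite inE M1; apply/exists_inP; exists 1%g => //; apply/invP => x y.
    by rewrite !pperm1E; split=> -[->].
  move=> a b; rewrite !inE => /andP[aM /exists_inP[a' a'M /invP aa']].
  move=> /andP[bM /exists_inP[b' b'M /invP bb']]; rewrite Mmul //=.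
  apply/exists_inP; exists (b' * a')%g; first exact: Mmul.
  apply/invP => x y; rewrite !ppermM; split.
    by case ax: (a x) => [z|] //= /bb' ->; apply/aa'.
  by case b'y: (b' y) => [z|] //= /aa' ->; apply/bb'.
have /subsetP/(_ _ sM) : M \subset S.
  apply: gen_submonoid_sub => //; apply/subsetP => a aG.
  have aM : a \in M := subsetP (sub_gen_submonoid G) _ aG.
  rewrite inE aM; have [t [B [at_ tB]]] := Gst a aG.
  apply/exists_inP; exists (res t^-1%g B); first by apply: res_stable_inv; rewrite -?at_.
  apply/invP => x y; rewrite at_ !resE; split.
    case: ifP => // xB [<-]; rewrite permK.
    by have := mem_imset B x (@perm_inj _ t); rewrite tB => ->; rewrite xB.
  case: ifP => // yB [<-]; rewrite permKV.
  by have := mem_imset B (t^-1%g y) (@perm_inj _ t); rewrite tB permKV => <-; rewrite yB.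
rewrite inE => /andP[_ /exists_inP[b bM /invP sb]].
suff <- : b = res s^-1%g (s @: A) by [].
apply: pperm_eqP => y; rewrite resE; case: ifP => [/imsetP[x xA ->]|yA].
  by rewrite permK; apply/sb; rewrite resE xA.
case by_: (b y) => [x|] //; move/sb: by_; rewrite resE; case: ifP => // xA [yx].
by rewrite -yx imset_f in yA.
Qed.

(** * The rotation, jumps and 3-cycles *)

Section Cycle.
Variable m : nat.
Local Notation n := m.+3.
Implicit Types (x y p q f : 'I_n) (s t : {perm 'I_n}) (A B : {set 'I_n}).

Lemma val_natr k : k < n -> val (k%:R : 'I_n)%R = k.
Proof. by move=> kn; rewrite -[k%:R%R]/(inZp 1 *+ k)%R Zp_mulrn /= mul1n modn_small ?modn_small. Qed.

Lemma natr_order : (n%:R = 0 :> 'I_n)%R.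
Proof. by apply: val_inj; rewrite -[n%:R%R]/(inZp 1 *+ n)%R Zp_mulrn /= mul1n modnn. Qed.

Lemma eq_addn p i j : i < n -> j < n -> (p + i%:R == p + j%:R)%R = (i == j).
Proof. by move=> hi hj; rewrite (inj_eq (addrI p)) -val_eqE !val_natr. Qed.

Lemma val_succ x : val (x + 1)%R = if x.+1 < n then x.+1 else 0.
Proof.
rewrite /= -[in RHS](addn1 x) modnDmr; case: ltnP => h; first by rewrite modn_small.
have -> : x + 1 = n by have := ltn_ord x; lia.
by rewrite modnn.
Qed.

Lemma succ_neq x : (x + 1 == x)%R = false.
Proof. by have := @eq_addn x 1 0; rewrite addr0; apply. Qed.

Lemma succ2_neq x : (x + 1 + 1 == x)%R = false.
Proof. by have := @eq_addn x 2 0; rewrite addr0 -addrA; apply. Qed.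

Lemma neq_succ x : (x == x + 1)%R = false. Proof. by rewrite eq_sym succ_neq. Qed.
Lemma neq_succ2 x : (x == x + 1 + 1)%R = false. Proof. by rewrite eq_sym succ2_neq. Qed.
Definition succ_neqE := (succ_neq, succ2_neq, neq_succ, neq_succ2).

Lemma predK x : (x - 1 + 1)%R = x. Proof. exact: subrK. Qed.

(** As [n] has the form [m.+3], ['I_n] is the ring of integers modulo n, in which adding 1 is the
    cyclic successor. *)
Definition cyc : {perm 'I_n} := perm (addIr (1 : 'I_n)%R).
Definition tau p : {perm 'I_n} := tperm p (p + 1)%R.

Lemma cycE x : cyc x = (x + 1)%R. Proof. by rewrite permE. Qed.
Lemma cycXE k x : (cyc ^+ k)%g x = (x + k%:R)%R.
Proof.
elim: k => [|k IH]; first by rewrite expg0 perm1 addr0.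
by rewrite expgSr permM IH cycE -natr1 addrA.
Qed.

Lemma cycX_order : (cyc ^+ n)%g = 1%g.
Proof.
by apply/permP => x; rewrite cycXE perm1 natr_order addr0.
Qed.

Lemma tauE p x : tau p x = if x == p then (p + 1)%R else if x == (p + 1)%R then p else x.
Proof. by rewrite permE. Qed.

Lemma tau2 p : (tau p * tau p)%g = 1%g. Proof. exact: tperm2. Qed.

Lemma odd_tau p : odd_perm (tau p).
Proof. by rewrite odd_tperm eq_sym succ_neq. Qed.

Lemma tau_cyc p : (tau p * cyc)%g = (cyc * tau (p + 1)%R)%g.
Proof.
apply/permP => x; rewrite !permM !cycE !tauE !(inj_eq (addIr _)).
by case: eqP => // _; case: eqP.
Qed.

(** The sign is governed by n minus the number of cycles, and the rotation is a single cycle. *)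
Lemma odd_cyc : odd_perm cyc = ~~ odd n.
Proof.
have -> : odd_perm cyc = odd #|'I_n| (+) odd #|porbits cyc| by [].
suff -> : porbits cyc = [set setT] by rewrite cards1 card_ord addbT.
apply/setP => X; rewrite inE; apply/imsetP/eqP => [[x _ ->]|->].
  apply/setP => y; rewrite inE; apply/porbitP; exists (val (y - x)%R).
  by rewrite cycXE Zp_nat valZpK addrC subrK.
exists 0%R => //; apply/esym/setP => y; rewrite inE; apply/porbitP; exists (val y).
by rewrite cycXE Zp_nat valZpK add0r.
Qed.

(* [tri p] is the 3-cycle (p p+1 p+2); with a hole at p+2 it is orientation-preserving. *)
Definition tri p : {perm 'I_n} := locked (tau (p + 1)%R * tau p)%g.

Lemma triE p x : tri p x = if x == p then (p + 1)%R else
   if x == (p + 1)%R then (p + 1 + 1)%R else if x == (p + 1 + 1)%R then p else x.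
Proof.
rewrite /tri -lock permM !tauE; case: (x =P p) => [->|]; last case: (x =P (p + 1)%R) => [->|] //.
- by rewrite !succ_neqE ?eqxx.
- by rewrite ?succ_neqE ?eqxx ?succ_neqE ?eqxx.
by move=> /eqP/negbTE xp1 /eqP/negbTE xp; case: (x =P (p + 1 + 1)%R) => _;
  rewrite ?succ_neqE ?eqxx ?xp ?xp1.
Qed.

(** This is how the 3-cycle is obtained from the squared rotation and the squares of
    jump-and-rotate, the two kinds of elements available for either parity of n. *)
Lemma tri_cyc p : (tri p * cyc ^+ 2)%g = ((tau (p + 1)%R * cyc) ^+ 2)%g.
Proof. by rewrite /tri -lock !expgS expg0 !mulg1 !mulgA -(mulgA _ (tau p)) (tau_cyc p) !mulgA. Qed.

End Cycle.

(** * Jumps in the presence of two holes *)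

Section Holes.
Variable m : nat.
Local Notation n := m.+3.
Implicit Types (x y p q f : 'I_n) (s t : {perm 'I_n}) (A B : {set 'I_n}).

Variable M : {set pperm n}.
Hypothesis Mm : is_submonoid M.
Hypothesis Minv : forall s A, res s A \in M -> res s^-1%g (s @: A) \in M.
Hypothesis Mcyc2 : res (cyc m ^+ 2)%g setT \in M.
Hypothesis Mrho2 : forall p, res ((tau p * cyc m) ^+ 2)%g (~: [set p + 1]%R) \in M.

(** An element with one hole times its inverse is the idempotent missing one point; the other
    idempotents are built from these by adding one hole at a time. *)
Lemma res1_in A : res 1%g A \in M.
Proof.
have [M1 Mmul] := is_submonoidP _ Mm.
have hole q : res 1%g (~: [set q]) \in M.
  have := Mrho2 (q - 1)%R; rewrite predK => rM.
  by have := resM_in Mm rM (Minv rM); rewrite mulgV; apply=> x; apply: imset_f.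
have [k le_k] := ubnP #|~: A|; elim: k => // k IH in A le_k *.
have [A0|[q]] := set_0Vmem (~: A); first by rewrite -[A]setCK A0 setC0 res1T.
rewrite inE => qA.
suff -> : res 1%g A = (res 1 (q |: A) * res 1 (~: [set q]))%g.
  rewrite Mmul ?hole // IH // -ltnS (leq_trans _ le_k) // ltnS.
  by rewrite [X in _ <= X](cardsD1 q) !inE qA add1n ltnS subset_leq_card //;
    apply/subsetP => x; rewrite !inE negb_or.
rewrite resM mulg1; congr res; apply/setP => x; rewrite !inE perm1.
by case: eqP => [->|]; rewrite ?(negbTE qA) ?andbT.
Qed.

Lemma res_sub_in s A B : res s B \in M -> {subset A <= B} -> res s A \in M.
Proof. by move=> sB AB; rewrite -[s]mul1g (resM_in Mm (res1_in A) sB) // => x; rewrite perm1 => /AB. Qed.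

Lemma resV_in s A B :
  res s B \in M -> (forall x, x \in A -> (s^-1)%g x \in B) -> res s^-1%g A \in M.
Proof.
move=> /Minv sB AB; apply: res_sub_in sB _ => x /AB xB.
by rewrite -[x](permKV s) imset_f.
Qed.

Lemma cycV2_in A : res (cyc m ^- 2)%g A \in M.
Proof. exact: resV_in Mcyc2 _. Qed.

Lemma tri_in p A : (p + 1 + 1)%R \notin A -> res (tri p) A \in M.
Proof.
move=> pA; rewrite -(mulgK (cyc m ^+ 2)%g (tri p)) tri_cyc.
apply: (resM_in Mm (B := setT)) (cycV2_in _) _ => //.
apply: res_sub_in (Mrho2 _) _ => x xA.
by rewrite !inE; apply: contraTneq xA => ->.
Qed.

Lemma triV_in p A : p \notin A -> res (tri p)^-1%g A \in M.
Proof.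
move=> pA; apply: (resV_in (@tri_in p (~: [set p + 1 + 1]%R) _)); rewrite ?inE ?eqxx // => x xA.
rewrite !inE; apply: contraNneq pA => /(congr1 (tri p)); rewrite permKV triE !succ_neqE eqxx.
by move=> <-.
Qed.

(* The second hole is at distance k ahead of p+1; conjugating by [tri] brings it two
   places closer. *)
Lemma tau_in_right k p A :
  0 < k < n -> (p + 1)%R \notin A -> (p + 1 + k%:R)%R \notin A -> res (tau p) A \in M.
Proof.
elim/ltn_ind: k p A => k IH p A /andP[k0 kn] p1A qA.
have in_neq x y : x \in A -> y \notin A -> (x == y) = false.
  by move=> xA; apply: contraNF => /eqP <-.
(* If [k.+1 = n], the second hole is [p] itself, so the jump moves no point of [A]. *)
have [ekn|kn'] := eqVneq k.+1 n.
  have pA : p \notin A.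
    by move: qA; rewrite -addrA (addrC _ k%:R%R) natr1 ekn natr_order addr0.
  rewrite -(@eq_res _ 1%g) ?res1_in // => x xA.
  by rewrite perm1 tauE !in_neq.
case: k => [|[|[|k]]] // in IH k0 kn qA kn' *.
- rewrite -(@eq_res _ (tri p)) ?tri_in // => x xA.
  by rewrite triE tauE [(x == p + 1)%R]in_neq // [(x == p + 1 + 1)%R]in_neq.
- have n4 : 3 < n by lia.
  have neq3 x : (x + 1 + 1 + 1 == x)%R = false.
    by have := @eq_addn _ x 3 0; rewrite addr0 -!addrA; apply.
  have neq3' x : (x == x + 1 + 1 + 1)%R = false by rewrite eq_sym.
  have q'A : (p + 1 + 1 + 1)%R \notin A by rewrite -[(_ + 1 + 1)%R]addrA.
  pose neqE := (neq3, neq3', succ_neqE, eqxx).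
  have split4 (P : 'I_n -> Prop) : P p -> P (p + 1)%R -> P (p + 1 + 1)%R ->
      P (p + 1 + 1 + 1)%R -> (forall x, (x == p) = false -> (x == p + 1)%R = false ->
      (x == p + 1 + 1)%R = false -> (x == p + 1 + 1 + 1)%R = false -> P x) -> forall x, P x.
    move=> P0 P1 P2 P3 P4 x.
    have [->|/negbTE x0] // := eqVneq x p; have [->|/negbTE x1] // := eqVneq x (p + 1)%R.
    have [->|/negbTE x2] // := eqVneq x (p + 1 + 1)%R.
    by have [->|/negbTE x3] // := eqVneq x (p + 1 + 1 + 1)%R; apply: P4.
  (* With holes at [p + 1] and [p + 3], the point at [p + 2] steps aside to [p + 3], the point at
     [p] advances two places, and the last factor moves both back by one. *)
  rewrite -(@eq_res _ (tri (p + 1)%R * (tri p * (tri p * (tri (p + 1)%R)^-1)))%g); last first.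
    move=> x xA; apply: (@perm_inj _ (tri (p + 1)%R)); rewrite !permM permKV.
    elim/split4: x xA => [||||x x0 x1 x2 x3] xA; try by rewrite ?(negbTE p1A) ?(negbTE q'A) in xA.
    - by rewrite tauE !triE !neqE.
    - by rewrite tauE !triE !neqE.
    - by rewrite tauE !triE !(x0, x1, x2, x3).
  apply: (resM_in Mm (B := ~: [set (p + 1)%R; (p + 1 + 1)%R])); first exact: tri_in.
    apply: (resM_in Mm (B := ~: [set p; p + 1 + 1]%R)).
    - by rewrite tri_in // !inE eqxx orbT.
    - apply: (resM_in Mm (B := ~: [set p; p + 1]%R)).
      + by rewrite tri_in // !inE eqxx orbT.
      + by rewrite triV_in // !inE eqxx orbT.
      + elim/split4 => [||||x x0 x1 x2 x3]; rewrite !inE triE ?neqE ?orbT //.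
        by rewrite !(x0, x1, x2, x3).
    - elim/split4 => [||||x x0 x1 x2 x3]; rewrite !inE triE ?neqE ?orbT //.
      by rewrite !(x0, x1, x2, x3).
  elim/split4 => [||||x x0 x1 x2 x3] xA; rewrite !inE triE ?neqE //.
  - by rewrite (negbTE p1A) in xA.
  - by rewrite (negbTE q'A) in xA.
  - by rewrite !(x0, x1, x2, x3).
(* [tri z] turns the hole at [z + 2] into one at [z]; its support avoids [p] and [p + 1], so
   conjugation leaves the jump unchanged. *)
- pose z := (p + 1 + k.+1%:R)%R.
  have z2A : (z + 1 + 1)%R \notin A by rewrite /z -!addrA -natr1 -natr1 !addrA in qA *.
  have zE i : (z + i%:R = p + (k.+2 + i)%:R)%R by rewrite /z natrD -natr1 -!natr1; ring.
  have neq_pz i : i < 3 -> (p == z + i%:R)%R = false.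
    by move=> i3; rewrite zE -[X in X == _]addr0; apply: (@eq_addn _ p 0); lia.
  have neq_p1z i : i < 3 -> (p + 1 == z + i%:R)%R = false.
    by move=> i3; rewrite zE; apply: (@eq_addn _ p 1); lia.
  have pz : (p == z) = false by rewrite -[z]addr0; apply: (neq_pz 0).
  have pz1 : (p == z + 1)%R = false by apply: (neq_pz 1).
  have pz2 : (p == z + 1 + 1)%R = false by rewrite -addrA; apply: (neq_pz 2).
  have p1z : (p + 1 == z)%R = false by rewrite -[z]addr0; apply: (neq_p1z 0).
  have p1z1 : (p + 1 == z + 1)%R = false by apply: (neq_p1z 1).
  have p1z2 : (p + 1 == z + 1 + 1)%R = false by rewrite -addrA; apply: (neq_p1z 2).
  have pzE := (pz, pz1, pz2, p1z, p1z1, p1z2).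
  have pzE' : ((z == p) = false) * ((z + 1 == p)%R = false) * ((z + 1 + 1 == p)%R = false) *
      ((z == p + 1)%R = false) * ((z + 1 == p + 1)%R = false) * ((z + 1 + 1 == p + 1)%R = false).
    by repeat split; rewrite eq_sym pzE.
  pose neqE := (pzE, pzE', succ_neqE, eqxx).
  have split5 (P : 'I_n -> Prop) : P p -> P (p + 1)%R -> P z -> P (z + 1)%R ->
      P (z + 1 + 1)%R -> (forall x, (x == p) = false -> (x == p + 1)%R = false ->
      (x == z) = false -> (x == z + 1)%R = false -> (x == z + 1 + 1)%R = false -> P x) ->
      forall x, P x.
    move=> P0 P1 P2 P3 P4 P5 x.
    have [->|/negbTE x0] // := eqVneq x p; have [->|/negbTE x1] // := eqVneq x (p + 1)%R.
    have [->|/negbTE x2] // := eqVneq x z; have [->|/negbTE x3] // := eqVneq x (z + 1)%R.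
    by have [->|/negbTE x4] // := eqVneq x (z + 1 + 1)%R; apply: P5.
  rewrite -(@eq_res _ (tri z * (tau p * (tri z)^-1))%g); last first.
    move=> x xA; apply: (@perm_inj _ (tri z)); rewrite !permM permKV.
    by elim/split5: x {xA} => [|||||x x0 x1 x2 x3 x4]; rewrite !tauE !triE ?neqE // !(x0, x1, x2, x3, x4).
  apply: (resM_in Mm (B := ~: [set (p + 1)%R; z])); first exact: tri_in.
    apply: (resM_in Mm (B := ~: [set z])).
    - by apply: (IH k.+1); rewrite // ?(ltnW (ltnW kn)) // !inE eqxx ?orbT.
    - by rewrite triV_in // !inE eqxx.
    - elim/split5 => [|||||x x0 x1 x2 x3 x4]; rewrite !inE tauE ?neqE ?orbT //.
      by rewrite !(x0, x1, x2, x3, x4).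
  elim/split5 => [|||||x x0 x1 x2 x3 x4] xA; rewrite !inE triE ?neqE //.
  - by rewrite (negbTE p1A) in xA.
  - by rewrite (negbTE z2A) in xA.
  - by rewrite !(x0, x1, x2, x3, x4).
Qed.

(* The restriction with the hole at [p] is the inverse of one with the hole at [p + 1]. *)
Lemma tau_in p f q A : (f == p) || (f == p + 1)%R -> q != f ->
  f \notin A -> q \notin A -> res (tau p) A \in M.
Proof.
have right r B : r != (p + 1)%R -> (p + 1)%R \notin B -> r \notin B -> res (tau p) B \in M.
  move=> rp p1B rB; apply: (@tau_in_right (val (r - (p + 1))%R)) p1B _.
    rewrite ltn_ord andbT lt0n; rewrite -subr_eq0 in rp; apply: contraNneq rp => r0.
    by apply/eqP/val_inj.
  by rewrite Zp_nat valZpK addrC subrK.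
case/orP=> /eqP -> qf fA qA; last exact: right qf fA qA.
have tauV : (tau p)^-1%g = tau p by rewrite tpermV.
have [eq_q|qp1] := eqVneq q (p + 1)%R; first by apply: right (_ : p != p + 1)%R _ _; rewrite ?neq_succ -?eq_q.
rewrite -tauV; apply: (resV_in (B := ~: [set (p + 1)%R; q])).
  by apply: right qp1 _ _; rewrite !inE eqxx ?orbT.
move=> x xA; rewrite tauV !inE tauE.
have [xp|xp] := eqVneq x p; first by rewrite -xp xA in fA.
have [_|xp1] := eqVneq x (p + 1)%R; first by rewrite neq_succ eq_sym (negbTE qf).
by rewrite (negbTE xp1) /=; apply: contraNneq qA => <-.
Qed.

End Holes.

(** * Cyclic order *)

(** Strict cyclic order: going upwards from [a] round the circle, [b] is met before [c]. *)
Definition cyc3 (a b c : nat) := [|| a < b < c, b < c < a | c < a < b].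

Definition cyclic_on n (s : {perm 'I_n}) (A : {set 'I_n}) :=
  forall x y z : 'I_n, x \in A -> y \in A -> z \in A -> cyc3 x y z -> cyc3 (s x) (s y) (s z).

Definition increasing_on n (s : {perm 'I_n}) (A : {set 'I_n}) :=
  forall x y : 'I_n, x \in A -> y \in A -> x < y -> s x < s y.

(** * Reduction by rotations and jumps *)

Section Moves.
Variable m : nat.
Local Notation n := m.+3.
Implicit Types (x y p q f : 'I_n) (s t : {perm 'I_n}) (A B : {set 'I_n}).

Lemma val_pred x : 0 < x -> val (x - 1)%R = x.-1.
Proof.
move=> x0; have := val_succ (x - 1)%R; rewrite predK.
by case: ifP => _ xE; rewrite xE in x0 *.
Qed.

Lemma val_sub x y : val (x - y)%R = if y <= x then x - y else n + x - y.
Proof.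
have yn := ltn_ord y; have xn := ltn_ord x.
have [y0|y0] := posnP y.
  by rewrite y0 leq0n subn0 (_ : y = 0)%R ?subr0 //; apply: val_inj.
rewrite /= (@modn_small (n - y)) ?ltn_subrL ?y0 //; case: leqP => le_yx.
  by rewrite (_ : x + (n - y) = x - y + n) ?modnDr ?modn_small; lia.
by rewrite modn_small; lia.
Qed.

(** Rotating the image of the least point of [A] to 0 cuts the cyclic order open there and makes it
    linear. *)
Lemma cyclic_rotation s A : cyclic_on s A -> exists k, increasing_on (s * cyc m ^+ k)%g A.
Proof.
move=> sA; have [->|[a aA]] := set_0Vmem A; first by exists 0 => x y; rewrite inE.
have [x0 x0A minx0] := arg_minnP (fun x : 'I_n => val x) aA.
exists (val (- s x0)%R) => x y xA yA xy; rewrite !permM !cycXE Zp_nat valZpK.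
rewrite !val_sub.
have := minx0 _ xA; rewrite leq_eqVlt => /orP[/eqP/val_inj x0x|x0x].
  rewrite -x0x leqnn subnn.
  have : s y != s x0 by apply: contraTneq xy => /perm_inj ->; rewrite x0x ltnn.
  rewrite -val_eqE /=; have := ltn_ord (s x0); have := ltn_ord (s y).
  by case: (leqP (s x0) (s y)); lia.
have := sA _ _ _ x0A xA yA; rewrite /cyc3 x0x xy => /(_ isT).
have := ltn_ord (s x0); have := ltn_ord (s y); have := ltn_ord (s x).
by case: (leqP (s x0) (s y)); case: (leqP (s x0) (s x)); lia.
Qed.

(** The image is downward closed, so the points of [A] below [x] are mapped bijectively onto the
    values below [s x]. *)
Lemma increasing_rank s A :
  increasing_on s A -> (forall x y, x \in A -> y < s x -> exists2 z, z \in A & s z = y) ->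
  forall x, x \in A -> s x = #|[set y in A | y < x]| :> nat.
Proof.
move=> sA dn x xA; have -> : #|[set y in A | y < x]| = #|[set y : 'I_n | y < s x]|.
  rewrite -(card_imset _ (@perm_inj _ s)); apply: eq_card => y; rewrite inE.
  apply/imsetP/idP => [[z]|ysx]; first by rewrite inE => /andP[zA zx] ->; apply: sA.
  have [z zA zy] := dn _ _ xA ysx; exists z; rewrite // inE zA /= ltnNge leq_eqVlt.
  apply/negP => /orP[/eqP/val_inj xz|/(sA _ _ xA zA)]; first by rewrite xz zy ltnn in ysx.
  by rewrite zy => /(ltn_trans ysx); rewrite ltnn.
have le_n := ltnW (ltn_ord (s x)).
have wi : injective (widen_ord le_n) by move=> i j /(congr1 val) ij; apply: val_inj.
rewrite -[LHS]card_ord -(card_imset _ wi); apply: eq_card => y; rewrite inE.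
apply/imsetP/idP => [[i _ ->]|ysx]; first exact: (ltn_ord i).
by exists (Ordinal ysx) => //; apply: val_inj.
Qed.

Section Reach.
Variables (A : {set 'I_n}) (P : {perm 'I_n} -> Prop).
Hypothesis P1 : P 1%g.
Hypothesis Pcyc : forall s, P s -> P (s * cyc m)%g.
Hypothesis Ptau : forall s p f, (f == p) || (f == p + 1)%R ->
  (forall x, x \in A -> s x != f) -> P s -> P (s * tau p)%g.
Hypothesis Peq : forall s t, (forall x, x \in A -> s x = t x) -> P s -> P t.

Lemma reach_cycX s k : P (s * cyc m ^+ k)%g <-> P s.
Proof.
have PX t j : P t -> P (t * cyc m ^+ j)%g.
  by move=> Pt; elim: j => [|j IH]; rewrite ?expg0 ?mulg1 // expgSr mulgA; apply: Pcyc.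
split=> [/(PX _ (n.-1 * k))|]; last exact: PX.
by rewrite -mulgA -expgD -mulSn /= expgM cycX_order expg1n mulg1.
Qed.

(** A jump is an involution: afterwards the hole is at [tau p f], and the same jump leads back. *)
Lemma reach_tau s p f : (f == p) || (f == p + 1)%R ->
  (forall x, x \in A -> s x != f) -> P (s * tau p)%g <-> P s.
Proof.
move=> fp sf; split; last exact: Ptau sf.
move=> /(@Ptau _ p (tau p f)); rewrite -mulgA tau2 mulg1; apply.
  by rewrite tauE; case/orP: fp => /eqP ->; rewrite ?succ_neqE ?eqxx ?orbT.
by move=> x /sf; rewrite permM (inj_eq perm_inj).
Qed.

(* Pushing the image down as far as possible leads to the rank function of [A]. *)
Lemma reach_canonical s : increasing_on s A ->
  exists t, (P s <-> P t) /\ forall x, x \in A -> t x = #|[set y in A | y < x]| :> nat.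
Proof.
have [k le_k] := ubnP (\sum_(x in A) s x); elim: k => // k IH in s le_k *.
move=> sA; case: (boolP [exists x in A, exists y : 'I_n, (y < s x) && [forall z in A, s z != y]]); last first.
  move=> /exists_inPn noex; exists s; split=> //; apply: increasing_rank => // x y xA ysx.
  have /existsPn/(_ y) := noex _ xA; rewrite ysx /= negb_forall_in => /exists_inP[z zA].
  by rewrite negbK => /eqP <-; exists z.
move=> /exists_inP[x0 x0A /existsP[y0 /andP[y0x0 /forall_inP y0A]]].
(* Among the points mapped above the missing value [y0], the one with least image has a hole
   directly below that image. *)
have [x [xA sx0 sx]] : exists x, [/\ x \in A, 0 < s x & forall z, z \in A -> s z != (s x - 1)%R].
  have Qx0 : (x0 \in A) && (y0 < s x0) by rewrite x0A.
  have [x /andP[xA ysx] minx] := @arg_minnP _ _ (fun x => (x \in A) && (y0 < s x)) (fun x => s x) Qx0.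
  have sx0 : 0 < s x by apply: leq_ltn_trans ysx.
  exists x; split=> // z zA; apply/eqP => sz.
  have szE : s z = (s x).-1 :> nat by rewrite sz val_pred.
  have zy : s z <> y0 by apply/eqP/y0A.
  have : y0 < s z.
    rewrite ltn_neqAle; apply/andP; split; last by rewrite szE; lia.
    by apply/eqP => yz; apply: zy; apply: val_inj.
  by move=> yz; have := minx z; rewrite zA yz /= szE => /(_ isT); lia.
pose p := (s x - 1)%R; have pE : p = (s x).-1 :> nat by exact: val_pred.
have tE y : y \in A -> (s * tau p)%g y = if y == x then p else s y.
  by move=> yA; rewrite permM tauE (negbTE (sx _ yA)) predK (inj_eq perm_inj).
have [||t [Pt tr]] := IH (s * tau p)%g.
- rewrite -ltnS (leq_trans _ le_k) // ltnS (bigD1 x) //= [X in _ < X](bigD1 x) //=.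
  rewrite tE // ifT // -addSn leq_add //; first by rewrite pE prednK.
  by apply: leq_sum => y /andP[yA yx]; rewrite tE // (negbTE yx).
- move=> y z yA zA yz; rewrite !tE //; have := sA _ _ yA zA yz.
  case: eqP => [->|_]; case: eqP => [->|_] //; rewrite ?pE ?ltnn //.
  + by lia.
  + have : nat_of_ord (s y) != p by rewrite (inj_eq val_inj) sx.
    by rewrite pE; lia.
exists t; split=> //; rewrite -Pt; apply: iff_sym; apply: (@reach_tau _ p p); rewrite ?eqxx //.
Qed.

(** After a rotation [s] becomes increasing, and it and the identity then both reduce to the rank
    function of [A]. All moves are reversible, so [P] is carried from 1 to [s]. *)
Theorem reach_cyclic s : cyclic_on s A -> P s.
Proof.
move=> /cyclic_rotation[k /reach_canonical[t [st tE]]].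
have [|t1 [P1t t1E]] := @reach_canonical 1%g; first by move=> x y _ _; rewrite !perm1.
apply/(reach_cycX s k)/st/(Peq _ (proj1 P1t P1)) => x xA.
by apply: val_inj; rewrite /= tE ?t1E.
Qed.

End Reach.
End Moves.

(** * One descent and cyclic order *)

Lemma descent_between (u : nat -> nat) i k :
  i < k -> u k < u i -> exists2 d, i <= d < k & u d.+1 < u d.
Proof.
elim: k => // k IH; rewrite ltnS leq_eqVlt => /orP[/eqP-> uk|ik uk].
  by exists k; rewrite ?leqnn ?ltnSn.
case: (ltnP (u k.+1) (u k)) => [uk'|uk']; first by exists k; rewrite // (ltnW ik) ltnSn.
have [d /andP[id dk] ud] := IH ik (leq_ltn_trans uk' uk).
by exists d => //; lia.
Qed.

(* Of the three arcs between i < j < k, an anticyclic triple of values descends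
   along at least two. *)
Lemma one_descentP (u : seq nat) : uniq u ->
  reflect (forall i j k, i < j < k -> k < size u -> cyc3 (nth 0 u i) (nth 0 u j) (nth 0 u k))
    (#|[set i : 'I_(size u) | nth 0 u (ordS i) < nth 0 u i]| <= 1).
Proof.
move=> uu; apply: (iffP card_le1_eqP) => [one i j k /andP[ij jk] kn|cy d d'].
  pose desc d := d < size u /\ nth 0 u (d.+1 %% size u) < nth 0 u d.
  have {}one d d' : desc d -> desc d' -> d = d'.
    move=> [dn ud] [d'n ud'].
    by have /(congr1 val) : Ordinal dn = Ordinal d'n by apply: one; rewrite inE.
  have descS d l : l < size u -> d < l -> nth 0 u d.+1 < nth 0 u d -> desc d.
    by move=> ln dl ud; split; [lia|rewrite modn_small //; lia].
  have neq a b : a < b -> b < size u -> nth 0 u a != nth 0 u b.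
    by move=> ab bn; rewrite nth_uniq ?(ltn_trans ab) // neq_ltn ab.
  have nij := neq _ _ ij (ltn_trans jk kn); have njk := neq _ _ jk kn.
  have nik := neq _ _ (ltn_trans ij jk) kn.
  have D1 : nth 0 u j < nth 0 u i -> exists2 d, i <= d < j & desc d.
    case/(descent_between ij) => d idj ud; exists d => //; apply: (descS _ k) => //; lia.
  have D2 : nth 0 u k < nth 0 u j -> exists2 d, j <= d < k & desc d.
    case/(descent_between jk) => d jdk ud; exists d => //; apply: (descS _ k) => //; lia.
  (* The third arc passes the end of the sequence: the descent is found after [k], before [i], or at
     the step from the last entry to the first. *)
  have D3 : nth 0 u i < nth 0 u k -> exists2 d, (k <= d) || (d < i) & desc d.
    move=> uik; have ln : (size u).-1 < size u by lia.
    case: (ltnP (nth 0 u (size u).-1) (nth 0 u k)) => ulk.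
      have kl : k < (size u).-1.
        by rewrite ltn_neqAle; apply/andP; split; [apply: contraTneq ulk => <-; rewrite ltnn|lia].
      have [d kdl ud] := descent_between kl ulk.
      by exists d; [lia|apply: (descS _ _ ln); lia].
    case: (ltnP (nth 0 u i) (nth 0 u 0)) => ui0.
      have i0 : 0 < i by rewrite lt0n; apply: contraTneq ui0 => ->; rewrite ltnn.
      have [d kdl ud] := descent_between i0 ui0.
      by exists d; [lia|apply: (descS _ _ kn); lia].
    exists (size u).-1; first lia.
    by split; rewrite // prednK ?modnn; lia.
  have n12 : nth 0 u j < nth 0 u i -> nth 0 u k < nth 0 u j -> False.
    by move=> /D1[d1 hd1 /one dE] /D2[d2 hd2 /dE]; lia.
  have n13 : nth 0 u j < nth 0 u i -> nth 0 u i < nth 0 u k -> False.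
    by move=> /D1[d1 hd1 /one dE] /D3[d2 hd2 /dE]; lia.
  have n23 : nth 0 u k < nth 0 u j -> nth 0 u i < nth 0 u k -> False.
    by move=> /D2[d1 hd1 /one dE] /D3[d2 hd2 /dE]; lia.
  by rewrite /cyc3; lia.
(* Conversely, two descents violate the cyclic order of triples among their positions and cyclic
   successors. Coincidences among these indices give the cases; a sequence of two entries is
   contradictory at once. *)
wlog ltdd' : d d' / d < d'.
  move=> H; rewrite !inE => ud ud'; apply: val_inj => /=.
  by case: (ltngtP d d') => // dd; [have := H d d' dd|have := H d' d dd]; rewrite !inE ud ud' => /(_ isT isT) ->.
rewrite !inE /= => ud ud'; exfalso; have d'n := ltn_ord d'.
have dn : d.+1 < size u by lia.
rewrite modn_small // in ud.
have [d'n1|d'n1] := ltnP d'.+1 (size u).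
  rewrite modn_small // in ud'.
  have [dd'|dd'] := ltnP d.+1 d'.
    have := cy d d.+1 d'; have := cy d.+1 d' d'.+1; have := cy d d.+1 d'.+1.
    by rewrite /cyc3; lia.
  have e : d' = d.+1 :> nat by lia.
  by have := cy d d' d'.+1; rewrite e in ud' *; rewrite /cyc3; lia.
have e : d'.+1 = size u by lia.
rewrite e modnn in ud'.
have [d0|d0] := posnP d.
  rewrite d0 in ud dn ltdd'.
  have [dd'|dd'] := ltnP 1 d'; first by have := cy 0 1 d'; rewrite /cyc3; lia.
  have e1 : d' = 1 :> nat by lia.
  by rewrite e1 in ud'; lia.
have [dd'|dd'] := ltnP d.+1 d'.
  have := cy 0 d d.+1; have := cy 0 d d'; have := cy 0 d.+1 d'; have := cy d d.+1 d'.
  by rewrite /cyc3; lia.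
have e1 : d' = d.+1 :> nat by lia.
by have := cy 0 d d'; rewrite e1 in ud' *; rewrite /cyc3; lia.
Qed.

(** Along the increasing list [e] of [A] the image sequence consists of the values of [s], without
    repetition, so [one_descentP] applies; any cyclically ordered triple is a rotation of an
    increasing one. *)
Lemma orientation_preserving_res n (s : {perm 'I_n}) A :
  orientation_preserving (res s A) <-> cyclic_on s A.
Proof.
(* The empty domain is separate because [x0] serves as the default value of [nth]. *)
have [->|[x0 x0A]] := set_0Vmem A.
  split=> [_ x y z|_]; first by rewrite inE.
  rewrite /orientation_preserving (_ : image_seq _ = [::]).
    by rewrite (_ : [set _ | _] = set0) ?cards0 //; apply/setP => -[].
  by rewrite /image_seq; elim: (enum _) => //= a l IH; rewrite resE inE.
pose e := [seq x <- enum 'I_n | x \in A].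
have mem_e x : (x \in e) = (x \in A) by rewrite mem_filter mem_enum andbT.
have imE : image_seq (res s A) = [seq val (s x) | x <- e].
  rewrite /image_seq /e; elim: (enum _) => //= a l IH.
  by rewrite resE; case: (a \in A) => /=; rewrite IH.
have sorted_e : sorted (relpre val ltn) e.
  apply: sorted_filter; first by move=> y x z; apply: ltn_trans.
  by rewrite -sorted_map val_enum_ord iota_ltn_sorted.
have nth_lt i j : i < j -> j < size e -> nth x0 e i < nth x0 e j.
  move=> ij jn; have tr : transitive (relpre (@nat_of_ord n) ltn).
    by move=> y x z; apply: ltn_trans.
  by apply: (sorted_ltn_nth tr x0 sorted_e); rewrite ?inE //; apply: ltn_trans jn.
have uniq_im : uniq (image_seq (res s A)).
  rewrite imE map_inj_uniq ?filter_uniq -?enumT ?enum_uniq // => x y.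
  by move/val_inj/perm_inj.
have nthE i : i < size e -> nth 0 (image_seq (res s A)) i = s (nth x0 e i).
  by move=> ie; rewrite imE (nth_map x0).
have szE : size (image_seq (res s A)) = size e by rewrite imE size_map.
rewrite /orientation_preserving; split=> [/(one_descentP uniq_im) cy|cy].
  have {}cy x y z : x \in A -> y \in A -> z \in A -> x < y < z -> cyc3 (s x) (s y) (s z).
    rewrite -!mem_e => xe ye ze /andP[xy yz]; have := cy (index x e) (index y e) (index z e).
    have ltE a b : a \in e -> b \in e -> a < b -> index a e < index b e.
      move=> ae be; apply: contraTT; rewrite -!leqNgt leq_eqVlt => /orP[/eqP ab|ba].
        by rewrite -(nth_index x0 ae) -(nth_index x0 be) ab.
      by have := nth_lt _ _ ba; rewrite !nth_index // index_mem => /(_ ae)/ltnW.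
    by rewrite !ltE // szE !nthE ?index_mem // !nth_index //; apply.
  move=> x y z xA yA zA /or3P[] h.
  - exact: cy.
  - by have := cy _ _ _ yA zA xA h; rewrite /cyc3; lia.
  - by have := cy _ _ _ zA xA yA h; rewrite /cyc3; lia.
apply/(one_descentP uniq_im) => i j k /andP[ij jk]; rewrite szE => kn.
have jn := ltn_trans jk kn; have in_ := ltn_trans ij jn.
rewrite !nthE //; apply: cy; rewrite -?mem_e ?mem_nth // /cyc3.
by rewrite (nth_lt i j) ?(nth_lt j k).
Qed.

(** * Membership in the generated monoid *)

Lemma cyclic_onM n (s t : {perm 'I_n}) (A B : {set 'I_n}) :
  cyclic_on s A -> cyclic_on t B -> cyclic_on (s * t)%g (A :&: s @^-1: B).
Proof.
move=> sA tB x y z; rewrite !inE => /andP[xA xB] /andP[yA yB] /andP[zA zB] xyz.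
by rewrite !permM; apply: tB => //; apply: sA.
Qed.

Lemma AOP_P n (a : pperm n) :
  reflect (exists s, [/\ ~~ odd_perm s, cyclic_on s (pdom a) & a = res s (pdom a)])
          (a \in AOP n).
Proof.
rewrite !inE; apply: (iffP andP) => [[/alternatingP[s ev as_]]|[s [ev cy as_]]].
  by rewrite {1}as_ => /orientation_preserving_res cy; exists s.
split; first by apply/alternatingP; exists s.
by rewrite as_; apply/orientation_preserving_res.
Qed.

Lemma res_AOP n (s : {perm 'I_n}) A : ~~ odd_perm s -> cyclic_on s A -> res s A \in AOP n.
Proof. by move=> ev cy; apply/AOP_P; exists s; rewrite pdom_res. Qed.

Lemma AOP_submonoid n : is_submonoid (AOP n).
Proof.
apply/is_submonoidP; split.
  by rewrite -res1T res_AOP ?odd_perm1 // => x y z; rewrite !perm1.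
move=> a b /AOP_P[s [evs cys ->]] /AOP_P[t [evt cyt ->]].
by rewrite resM res_AOP ?odd_permM ?(negbTE evs) //; apply: cyclic_onM.
Qed.

Lemma fix_imset_setC1 n (s : {perm 'I_n}) q : s q = q -> s @: [set~ q] = [set~ q].
Proof.
move=> sq; apply/eqP; rewrite eqEcard card_imset ?leqnn ?andbT; last exact: perm_inj.
by apply/subsetP => _ /imsetP[x + ->]; rewrite !inE -{2}sq (inj_eq perm_inj).
Qed.

Lemma imset_permT n (s : {perm 'I_n}) : s @: setT = setT.
Proof. by apply/eqP; rewrite eqEcard subsetT card_imset ?leqnn //; apply: perm_inj. Qed.

(** All but one of the values determine a permutation, so its parity can be read off a restriction
    with at most one hole. *)
Lemma perm_eq_off1 n (s t : {perm 'I_n}) A : #|~: A| <= 1 ->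
  (forall x : 'I_n, x \in A -> s x = t x) -> s = t.
Proof.
move=> /card_le1_eqP A1 st; apply/permP => x; case: (boolP (x \in A)) => [/st//|xA].
case: (boolP ((t^-1)%g (s x) \in A)) => [yA|yA].
  by have := st _ yA; rewrite permKV => /perm_inj yx; rewrite yx (negbTE xA) in yA.
by rewrite [in RHS](_ : x = (t^-1)%g (s x)) ?permKV //; apply: A1; rewrite inE.
Qed.

(** * Generators as restrictions of permutations *)

Section Generators.
Variable m : nat.
Local Notation n := m.+3.
Implicit Types (x y p q f : 'I_n) (s t : {perm 'I_n}) (A B : {set 'I_n}).

(** The cycle of length n - 1 on the points other than [p + 1]: [g_1] and [g_n] are its restrictions
    for the first and the last point as [p + 1]. *)
Definition rho p : {perm 'I_n} := (tau p * cyc m)%g.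

Lemma rhoE p x : rho p x = if x == p then (p + 1 + 1)%R else
  if x == (p + 1)%R then (p + 1)%R else (x + 1)%R.
Proof. by rewrite permM cycE tauE; case: eqP => // _; case: eqP. Qed.

Lemma odd_rho p : odd_perm (rho p) = odd n.
Proof. by rewrite odd_permM odd_tau odd_cyc negbK. Qed.

Lemma rho_fix p : rho p (p + 1)%R = (p + 1)%R.
Proof. by rewrite rhoE succ_neqE eqxx. Qed.

Lemma rho_stable p : rho p @: [set~ p + 1]%R = [set~ p + 1]%R.
Proof. exact/fix_imset_setC1/rho_fix. Qed.

Lemma rho_conj p k : (rho p ^ (cyc m ^+ k))%g = rho (p + k%:R)%R.
Proof.
elim: k => [|k IH]; first by rewrite expg0 conjg1 addr0.
rewrite expgSr conjgM IH -natr1 addrA /rho conjgE !mulgA; congr (_ * _)%g.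
by rewrite -mulgA tau_cyc mulKg.
Qed.

Lemma insub_val k y : val y = k -> insub k = Some y.
Proof. by move=> <-; rewrite valK. Qed.

Lemma g_cyc_res : g_cyc n = res (cyc m) setT.
Proof.
apply: pperm_eqP => x; rewrite resE inE ffunE cycE; apply: insub_val.
rewrite val_succ; case: ltnP => xn; first by rewrite modn_small.
have -> : x.+1 = n by have := ltn_ord x; lia.
by rewrite modnn.
Qed.

Lemma g_first_res p : (p + 1 = 0)%R -> g_first n = res (rho p) [set~ p + 1]%R.
Proof.
move=> p1; apply: pperm_eqP => x; rewrite resE in_setC1 p1 ffunE.
rewrite -(inj_eq val_inj) /= -lt0n; case: ifP => // x0; apply: insub_val.
have xp : (x == p) = ~~ (x.+1 < n).
  rewrite -(inj_eq (addIr 1%R)) p1 -(inj_eq val_inj) val_succ.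
  by case: ltnP.
rewrite rhoE xp p1; case: (ltnP x.+1 n) => xn; last by rewrite val_succ.
have -> : (x == 0)%R = false by apply/negbTE; rewrite -(inj_eq val_inj) /= -lt0n.
by rewrite val_succ xn.
Qed.

Lemma g_last_res p : (p + 1 = -1)%R -> g_last n = res (rho p) [set~ p + 1]%R.
Proof.
move=> p1; have val_m1 : val (-1 : 'I_n)%R = n.-1.
  have := @val_succ m (-1)%R; rewrite addNr; case: ltnP => // le_n _.
  by apply/eqP; rewrite eqn_leq -ltnS (ltn_ord (-1 : 'I_n)%R).
have val_p : nat_of_ord p = n.-2.
  by have := val_succ p; rewrite p1 val_m1; case: ifP => _; lia.
apply: pperm_eqP => x; rewrite resE in_setC1 p1 ffunE.
have xn := ltn_ord x; have xm : (x < n.-1) = (x != -1)%R.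
  by rewrite -(inj_eq val_inj) val_m1 ltn_neqAle -ltnS xn andbT.
rewrite xm; case: ifP => // xm1; apply: insub_val; rewrite rhoE p1 (negbTE xm1).
have -> : (x == p) = (x.+1 == n.-1) by rewrite -(inj_eq val_inj) /= val_p.
case: eqP => [->|xp]; first by rewrite addNr modnn.
by rewrite val_succ modn_small ?ifT; lia.
Qed.

Lemma res_conj_in (M : {set pperm n}) s k q : is_submonoid M ->
  res (cyc m ^+ k)%g setT \in M -> res (cyc m ^- k)%g setT \in M ->
  res s [set~ q] \in M -> res (s ^ (cyc m ^+ k))%g [set~ q + k%:R]%R \in M.
Proof.
move=> /is_submonoidP[_ Mmul] kM kVM sM; have := Mmul _ _ (Mmul _ _ kVM sM) kM.
rewrite !resM conjgE mulgA; congr (res _ _ \in M); apply/setP => x.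
rewrite !inE /= andbT; congr (~~ _).
by rewrite -(inj_eq (@perm_inj _ (cyc m ^+ k)%g)) permKV cycXE.
Qed.

Lemma resV_full (M : {set pperm n}) s :
  (forall s A, res s A \in M -> res s^-1%g (s @: A) \in M) ->
  res s setT \in M -> res s^-1%g setT \in M.
Proof.
by move=> Minv /Minv; rewrite imset_permT.
Qed.

(** * Membership according to the number of holes *)

Section GenerationByHoles.
Variables (M : {set pperm n}) (A : {set 'I_n}).
Hypothesis Mm : is_submonoid M.
Hypothesis Minv : forall s A, res s A \in M -> res s^-1%g (s @: A) \in M.
Hypothesis Mcyc2 : res (cyc m ^+ 2)%g setT \in M.
Hypothesis Mrho2 : forall p, res (rho p ^+ 2)%g [set~ p + 1]%R \in M.

(** With two holes, one is left besides the hole jumped into, so [tau_in] supplies the jumps. The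
    rotation move stays a hypothesis because its justification depends on the parity of n. *)
Lemma res_small_in s : 1 < #|~: A| ->
  (forall t q r, q != r -> q \notin t @: A -> r \notin t @: A ->
     res t A \in M -> res (t * cyc m)%g A \in M) ->
  cyclic_on s A -> res s A \in M.
Proof.
case/card_gt1P => q1 [q2 [q1A q2A q12]] Mcyc.
have hole t q : q \in ~: A -> t q \notin t @: A.
  by rewrite mem_imset ?inE //; apply: perm_inj.
apply: (@reach_cyclic _ A (fun t => res t A \in M)).
- exact: res1_in Mm Minv Mrho2 A.
- by move=> t; apply: (Mcyc _ (t q1) (t q2)); rewrite ?hole ?(inj_eq perm_inj).
- move=> t p f fp tf tM; have fA : f \notin t @: A by apply/imsetP => -[x /tf/eqP tx /esym].
  have [q qf qA] : exists2 q, q != f & q \notin t @: A.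
    have [tq1|] := eqVneq (t q1) f; last by exists (t q1); rewrite ?hole.
    by exists (t q2); [rewrite -tq1 (inj_eq perm_inj) eq_sym|apply: hole].
  apply: (resM_in Mm tM (tau_in Mm Minv Mcyc2 Mrho2 fp qf fA qA)) => x.
  exact: imset_f.
- by move=> t u tu; rewrite (eq_res tu).
Qed.

(* With a single hole, an odd [t] is recorded as lying one step away from [M]. *)
Lemma res_big_odd_in s : odd n -> res (cyc m) setT \in M -> #|~: A| <= 1 ->
  cyclic_on s A -> ~~ odd_perm s -> res s A \in M.
Proof.
move=> oddn McT A1 cys evs; have cyc_ev : odd_perm (cyc m) = false by rewrite odd_cyc oddn.
have Mcyc t : res t A \in M -> res (t * cyc m)%g A \in M.
  by move=> tM; apply: (resM_in Mm tM McT) => x; rewrite inE.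
pose hole t f := forall x : 'I_n, x \in A -> t x != f.
have uniq_hole t f f' : hole t f -> hole t f' -> f = f'.
  move=> tf tf'; have notA g : hole t g -> (t^-1)%g g \in ~: A.
    by move=> tg; rewrite inE; apply/negP => /tg; rewrite permKV eqxx.
  by apply: (@perm_inj _ t^-1%g); apply: (card_le1_eqP A1); apply: notA.
pose P t := if odd_perm t then exists p f,
  [/\ (f == p) || (f == p + 1)%R, hole t f & res (t * tau p)%g A \in M] else res t A \in M.
suff : P s by rewrite /P (negbTE evs).
apply: (@reach_cyclic _ A P) => //.
- by rewrite /P odd_perm1 (res1_in Mm Minv Mrho2).
- move=> t; rewrite /P odd_permM cyc_ev addbF; case: ifP => _; last exact: Mcyc.
  move=> [p [f [fp tf tM]]]; exists (p + 1)%R, (f + 1)%R; split.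
  + by rewrite !(inj_eq (addIr _)).
  + by move=> x /tf; rewrite permM cycE (inj_eq (addIr _)).
  + by rewrite -mulgA -tau_cyc mulgA Mcyc.
- move=> t p f fp tf; rewrite /P odd_permM odd_tau addbT; case: ifP => _ /=.
    move=> [q [f' [fq tf' tM]]]; have ff := uniq_hole _ _ _ tf tf'; rewrite -{f'}ff in fq tf'.
    have [->//|pq] := eqVneq p q.
    (* Passing from [t * tau q] to [t * tau p] costs [tau q * tau p]; as both jumps use the hole
       [f], this is a [tri] or its inverse. *)
    rewrite -(mulKg (tau q) (tau p)) tpermV mulgA.
    case/orP: fp => /eqP fp; case/orP: fq => /eqP fq.
    + by rewrite -fp fq eqxx in pq.
    + have -> : (tau q * tau p)%g = (tri q)^-1%g.
        by rewrite -fp fq /tri -lock invMg !tpermV.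
      apply: (resM_in Mm tM (triV_in Mm Minv Mcyc2 Mrho2 (A := ~: [set q]) _)); rewrite ?inE ?eqxx //.
      by move=> x /tf; rewrite !inE permM tauE -fq => /negbTE ->; case: (t x =P q) => [_|/eqP //]; rewrite fq succ_neq.
    + have -> : (tau q * tau p)%g = tri p by rewrite -fq fp /tri -lock.
      apply: (resM_in Mm tM (tri_in Mm Minv Mcyc2 Mrho2 (A := ~: [set q + 1]%R) _)).
        by rewrite !inE -fq fp eqxx.
      move=> x /tf; rewrite !inE permM tauE -fq => /negbTE ->.
      by case: (t x =P (f + 1)%R) => [_|/eqP //]; rewrite neq_succ.
    + by move: pq; rewrite -(inj_eq (addIr 1%R)) -fp fq eqxx.
  move=> tM; exists p, (tau p f); split.
  + by rewrite tauE; case/orP: fp => /eqP ->; rewrite ?succ_neqE ?eqxx ?orbT.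
  + by move=> x /tf; rewrite permM (inj_eq perm_inj).
  + by rewrite -mulgA tau2 mulg1.
- by move=> t u /(perm_eq_off1 A1) ->.
Qed.

Section EvenDegree.
Hypothesis even_n : ~~ odd n.
Hypothesis Mrho : forall p, res (rho p) [set~ p + 1]%R \in M.

(** For [f = p], the inverse of [rho (p - 1)] is [tau p] followed by the inverse rotation, and the
    squared rotation corrects this to [tau p * cyc m]. *)
Lemma rho_in p f : (f == p) || (f == p + 1)%R -> res (tau p * cyc m)%g [set~ f] \in M.
Proof.
case/orP=> /eqP ->; last exact: Mrho.
have := Minv (Mrho (p - 1)%R); rewrite rho_stable predK => pM.
have := resM_in Mm pM Mcyc2.
rewrite /rho tau_cyc predK invMg tpermV -mulgA expgS mulKg expg1; apply=> x _.
by rewrite inE.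
Qed.

(* With a single hole, an odd [t] is recorded as lying one rotation away from [M]. *)
Lemma res_big_even_in s : #|~: A| <= 1 -> cyclic_on s A -> ~~ odd_perm s -> res s A \in M.
Proof.
move=> A1 cys evs; have cyc_odd : odd_perm (cyc m) by rewrite odd_cyc even_n.
pose P t := if odd_perm t then res (t * cyc m)%g A \in M else res t A \in M.
suff : P s by rewrite /P (negbTE evs).
have rho_step t p f : (f == p) || (f == p + 1)%R -> (forall x, x \in A -> t x != f) ->
    res t A \in M -> res (t * tau p * cyc m)%g A \in M.
  by move=> fp tf tM; rewrite -mulgA (resM_in Mm tM (rho_in fp)) // => x /tf; rewrite !inE.
apply: (@reach_cyclic _ A P) => //.
- by rewrite /P odd_perm1 (res1_in Mm Minv Mrho2).
- move=> t; rewrite /P odd_permM cyc_odd addbT; case: ifP => //= _ tM.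
  by rewrite -mulgA (resM_in Mm tM (Mcyc2 : res (cyc m * cyc m)%g _ \in M)).
- move=> t p f fp tf; rewrite /P odd_permM odd_tau addbT; case: ifP => _ /= tM.
    (* Here [t * cyc m] restricts into [M]. A jump at the rotated position and a rotation give
       [t * tau p * cyc m ^+ 2], and the squared rotation is removed. *)
    have := rho_step (t * cyc m)%g (p + 1)%R (f + 1)%R.
    rewrite !(inj_eq (addIr _)) -(mulgA t) -tau_cyc => /(_ fp).
    have cVM := cycV2_in Mm Minv Mcyc2 Mrho2 setT.
    move=> /(_ _ tM) tM'.
    have := resM_in Mm (tM' _) cVM.
    have -> : (t * (tau p * cyc m) * cyc m * cyc m ^- 2 = t * tau p)%g.
      by rewrite mulgA -(mulgA _ (cyc m) (cyc m)) -[(cyc m * cyc m)%g]/(cyc m ^+ 2)%g mulgK.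
    apply=> x; last by rewrite inE.
    by move=> /tf; rewrite permM cycE (inj_eq (addIr _)).
  exact: rho_step fp tf tM.
- by move=> t u /(perm_eq_off1 A1) ->.
Qed.

(** The rotation factors as [tau q * rho q]: the jump is available because of the second hole, and
    it leaves a hole at [q + 1], as [rho q] requires. *)
Lemma res_small_even_in s : 1 < #|~: A| -> cyclic_on s A -> res s A \in M.
Proof.
move=> A2 cys; apply: (res_small_in A2) => // t q r qr qA rA tM.
rewrite -(mulKg (tau q) (cyc m)) tpermV mulgA; apply: (resM_in Mm _ (Mrho q)).
  apply: (resM_in Mm tM (tau_in Mm Minv Mcyc2 Mrho2 (p := q) (f := q) (q := r) (A := t @: A) _ _ _ _)) => //.
  - by rewrite eqxx.
  - by rewrite eq_sym.
  - by move=> x; apply: imset_f.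
move=> x xA; rewrite !inE permM tauE; case: (t x =P q) => [tq|_].
  by rewrite -tq imset_f in qA.
by case: (t x =P (q + 1)%R) => [_|/eqP//]; rewrite neq_succ.
Qed.

End EvenDegree.

Lemma res_odd_in s : odd n -> res (cyc m) setT \in M ->
  cyclic_on s A -> ~~ odd_perm s -> res s A \in M.
Proof.
move=> oddn McT cys evs; case: (leqP #|~: A| 1) => A1; first exact: res_big_odd_in.
apply: (res_small_in A1) => // t q r _ _ _ tM.
by apply: (resM_in Mm tM McT) => x; rewrite inE.
Qed.

Lemma res_even_in s : ~~ odd n -> (forall p, res (rho p) [set~ p + 1]%R \in M) ->
  cyclic_on s A -> ~~ odd_perm s -> res s A \in M.
Proof.
move=> evn Mrho cys evs; case: (leqP #|~: A| 1) => A1; last exact: res_small_even_in.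
exact: res_big_even_in.
Qed.

End GenerationByHoles.
End Generators.

(** * Generation and minimality *)

Lemma cards3 (T : finType) (a b d : T) : a != b -> a != d -> b != d -> #|[set a; b; d]| = 3.
Proof.
by move=> ab ad bd; rewrite setUC cardsU1 cards2 ab !inE negb_or eq_sym ad eq_sym bd.
Qed.

(** * Total and partial elements *)

Section Total.
Variable n : nat.
Implicit Types a b : pperm n.

Lemma pdomM_sub a b : pdom (a * b)%g \subset pdom a.
Proof. by apply/subsetP => x; rewrite !inE ppermM; case: (a x). Qed.

Lemma total_submonoid : is_submonoid [set a : pperm n | pdom a == setT].
Proof.
apply/is_submonoidP; split; first by rewrite inE -res1T pdom_res.
move=> a b; rewrite !inE => /eqP aT /eqP bT; apply/eqP/setP => x.
rewrite !inE ppermM; have : x \in pdom a by rewrite aT inE.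
rewrite inE; case: (a x) => //= y _.
have : y \in pdom b by rewrite bT inE.
by rewrite inE.
Qed.

(** A product has its domain inside that of its first factor, so a partial first factor cannot be
    repaired; hence total elements other than 1 need a total generator. *)
Lemma one_or_partial_submonoid : is_submonoid [set a : pperm n | (a == 1%g) || (pdom a != setT)].
Proof.
apply/is_submonoidP; split; first by rewrite inE eqxx.
move=> a b; rewrite !inE => /orP[/eqP -> |aT bT]; first by rewrite mul1g.
apply/orP; right; apply: contraNneq aT => abT.
by rewrite eqEsubset subsetT -abT pdomM_sub.
Qed.

Lemma generates_total B a : generates (AOP n) B -> a \in AOP n -> pdom a = setT -> a != 1%g ->
  exists2 b, b \in B & pdom b = setT.
Proof.
move=> gB aA aT a1.
have [|b bB] := generates_notin gB one_or_partial_submonoid aA; first by rewrite inE aT negb_or a1 eqxx.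
by rewrite inE negb_or negbK => /andP[_ /eqP bT]; exists b.
Qed.

Lemma generates_partial B a : generates (AOP n) B -> a \in AOP n -> pdom a != setT ->
  exists2 b, b \in B & pdom b != setT.
Proof.
move=> gB aA aT; have [|b bB] := generates_notin gB total_submonoid aA; first by rewrite inE.
by rewrite inE; exists b.
Qed.

End Total.

Section MinimalGeneration.
Variable m : nat.
Local Notation n := m.+3.
Implicit Types (x y p q f : 'I_n) (s t : {perm 'I_n}) (A B : {set 'I_n}).

Lemma cyclic_on_cyc A : cyclic_on (cyc m) A.
Proof.
move=> x y z _ _ _; rewrite /cyc3 !cycE -![nat_of_ord (_ + _)%R]/(val _) !val_succ.
have := ltn_ord x; have := ltn_ord y; have := ltn_ord z.
by case: (ltnP x.+1 n); case: (ltnP y.+1 n); case: (ltnP z.+1 n); lia.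
Qed.

Lemma cyclic_on_tau p : cyclic_on (tau p) [set~ p + 1]%R.
Proof.
have qE : nat_of_ord (p + 1)%R = if p.+1 < n then p.+1 else 0 by exact: val_succ.
have tE x : x \in [set~ p + 1]%R -> nat_of_ord x <> nat_of_ord (p + 1)%R /\
    nat_of_ord (tau p x) = if nat_of_ord x == nat_of_ord p then nat_of_ord (p + 1)%R else nat_of_ord x.
  rewrite in_setC1 => xp; split; first by move/val_inj => xp1; rewrite xp1 eqxx in xp.
  by rewrite tauE (negbTE xp) -(inj_eq val_inj); case: eqP.
move=> x y z /tE[xq ->] /tE[yq ->] /tE[zq ->]; rewrite /cyc3.
move: (nat_of_ord (p + 1)%R) qE xq yq zq => q.
have := ltn_ord x; have := ltn_ord y; have := ltn_ord z; have := ltn_ord p.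
move: (nat_of_ord x) (nat_of_ord y) (nat_of_ord z) (nat_of_ord p) => a b d k.
by case: (ltnP k.+1 n); case: (a =P k) => ?; case: (b =P k) => ?; case: (d =P k) => ?; lia.
Qed.

Lemma cyclic_onW s A B : A \subset B -> cyclic_on s B -> cyclic_on s A.
Proof. by move=> /subsetP AB sB x y z /AB xB /AB yB /AB zB; apply: sB. Qed.

Lemma cyclic_on_rho p : cyclic_on (rho p) [set~ p + 1]%R.
Proof.
apply: (cyclic_onW _ (cyclic_onM (@cyclic_on_tau p) (@cyclic_on_cyc setT))).
by apply/subsetP => x xp; rewrite !inE -in_setC1 xp.
Qed.

Lemma res_rho_sq p : (res (rho p) [set~ p + 1]%R ^+ 2)%g = res (rho p ^+ 2)%g [set~ p + 1]%R.
Proof. by rewrite res_stable_exp ?rho_stable. Qed.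

Lemma res_cyc_sq : (res (cyc m) setT ^+ 2)%g = res (cyc m ^+ 2)%g setT.
Proof. by rewrite res_stable_exp // imset_permT. Qed.

Lemma rho_sq_AOP p : res (rho p ^+ 2)%g [set~ p + 1]%R \in AOP n.
Proof.
rewrite expgS expg1 res_AOP ?odd_permM ?addbb //.
apply: (cyclic_onW _ (cyclic_onM (@cyclic_on_rho p) (@cyclic_on_rho p))); apply/subsetP => x xp; rewrite in_setI xp /= inE.
by rewrite -rho_stable imset_f.
Qed.

Lemma cyc_sq_AOP : res (cyc m ^+ 2)%g setT \in AOP n.
Proof.
rewrite expgS expg1 res_AOP ?odd_permM ?addbb //.
by apply: (cyclic_onW _ (cyclic_onM (@cyclic_on_cyc setT) (@cyclic_on_cyc setT))); apply/subsetP => x; rewrite !inE.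
Qed.

Lemma subr1_addr1 : (-1 - 1 + 1 = -1 :> 'I_n)%R. Proof. exact: predK. Qed.

(** Conjugating the square of [g_n] by powers of [g] moves its hole to every point. *)
Theorem generates_odd : odd n -> generates (AOP n) [set g_cyc n; (g_last n ^+ 2)%g].
Proof.
move=> oddn; rewrite g_cyc_res (g_last_res subr1_addr1) res_rho_sq.
set p := (-1 - 1)%R; set G := [set _; _]; pose M := gen_submonoid G.
have Mm : is_submonoid M := gen_submonoid_is G; have GM := subsetP (sub_gen_submonoid G).
have Minv s A : res s A \in M -> res s^-1%g (s @: A) \in M.
  apply: gen_inverse_closed => _ /set2P[] ->.
    by exists (cyc m), setT; rewrite imset_permT.
  exists (rho p ^+ 2)%g, [set~ p + 1]%R; split=> //.
  by apply: fix_imset_setC1; rewrite expgS expg1 permM !rho_fix.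
have McT : res (cyc m) setT \in M by apply: GM; rewrite !inE eqxx.
have MXT k : res (cyc m ^+ k)%g setT \in M.
  case: k => [|k]; first by rewrite expg0 res1T; case/is_submonoidP: Mm.
  by rewrite -res_stable_exp ?submonoid_exp // imset_permT.
have Mrho2 q : res (rho q ^+ 2)%g [set~ q + 1]%R \in M.
  have -> : q = (p + (val (q - p))%:R)%R by rewrite Zp_nat valZpK addrC subrK.
  rewrite -rho_conj -conjXg addrAC; apply: res_conj_in => //; first exact: resV_full.
  by apply: GM; rewrite !inE eqxx orbT.
rewrite /generates eqEsubset gen_submonoid_sub ?AOP_submonoid //=; last first.
  apply/subsetP => _ /set2P[] ->; last exact: rho_sq_AOP.
  by rewrite res_AOP ?odd_cyc ?oddn //; apply: cyclic_on_cyc.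
apply/subsetP => a /AOP_P[s [evs cys aE]]; rewrite aE.
exact: (res_odd_in Mm Minv (MXT 2) Mrho2 oddn McT).
Qed.

Theorem generates_even : ~~ odd n ->
  generates (AOP n) [set (g_cyc n ^+ 2)%g; g_first n; g_last n].
Proof.
move=> evn; have p0E : (-1 + 1 = 0 :> 'I_n)%R by rewrite addNr.
rewrite g_cyc_res (g_first_res p0E) (g_last_res subr1_addr1) res_cyc_sq.
set p1 := (-1 - 1)%R; set p0 := (-1)%R in p0E *; set G := [set _; _; _]; pose M := gen_submonoid G.
have Mm : is_submonoid M := gen_submonoid_is G; have GM := subsetP (sub_gen_submonoid G).
have Minv s A : res s A \in M -> res s^-1%g (s @: A) \in M.
  apply: gen_inverse_closed => _ /setUP[/set2P[]|/set1P] ->.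
  - by exists (cyc m ^+ 2)%g, setT; rewrite imset_permT.
  - by exists (rho p0), [set~ p0 + 1]%R; rewrite rho_stable.
  - by exists (rho p1), [set~ p1 + 1]%R; rewrite rho_stable.
have Mc2 : res (cyc m ^+ 2)%g setT \in M by apply: GM; rewrite !inE eqxx.
have M2X k : res (cyc m ^+ (2 * k))%g setT \in M.
  rewrite expgM; case: k => [|k]; first by rewrite expg0 res1T; case/is_submonoidP: Mm.
  by rewrite -res_stable_exp ?submonoid_exp // imset_permT.
have Mrho q : res (rho q) [set~ q + 1]%R \in M.
  (* Conjugation by even powers of the rotation moves holes by even distances; [g_first] with hole 0
     and [g_last] with the odd hole n - 1 therefore cover all holes, selected by the parity of
     [q + 1]. *)
  have [[k ->]|[k ->]] : (exists k, q = p0 + (2 * k)%:R)%R \/ (exists k, q = p1 + (2 * k)%:R)%R.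
    have rE : ((val (q + 1))%:R = q + 1)%R by rewrite Zp_nat valZpK.
    case: (boolP (odd (val (q + 1)%R))) => oddq; [right|left].
      exists (val (q + 1)%R).+1./2; rewrite mul2n even_halfK ?oddS ?oddq //= -natr1 rE /p1; ring.
    exists (val (q + 1)%R)./2; rewrite mul2n even_halfK // rE /p0; ring.
  - by rewrite -rho_conj addrAC; apply: res_conj_in; rewrite ?resV_full ?M2X // GM // !inE eqxx ?orbT.
  - by rewrite -rho_conj addrAC; apply: res_conj_in; rewrite ?resV_full ?M2X // GM // !inE eqxx ?orbT.
have Mrho2 q : res (rho q ^+ 2)%g [set~ q + 1]%R \in M.
  by rewrite -res_rho_sq submonoid_exp.
rewrite /generates eqEsubset gen_submonoid_sub ?AOP_submonoid //=; last first.
  apply/subsetP => _ /setUP[/set2P[]|/set1P] ->; first exact: cyc_sq_AOP;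
    by rewrite res_AOP ?odd_rho //; apply: cyclic_on_rho.
apply/subsetP => a /AOP_P[s [evs cys aE]]; rewrite aE.
exact: (res_even_in Mm Minv Mc2 Mrho2 evn Mrho).
Qed.

(** Total elements are reached by rotations alone, and for even n each rotation flips both the sign
    and the parity of every value. *)
Lemma total_parity s : ~~ odd n -> ~~ odd_perm s -> cyclic_on s setT ->
  forall x, odd (s x) = odd x.
Proof.
move=> evn evs cys; suff sP : forall x : 'I_n, odd (s x) = odd x (+) odd_perm s.
  by move=> x; rewrite sP (negbTE evs) addbF.
apply: (@reach_cyclic _ setT (fun t => forall x : 'I_n, odd (t x) = odd x (+) odd_perm t)) => //.
- by move=> x; rewrite odd_perm1 perm1 addbF.
- move=> t tP x; rewrite permM cycE odd_permM odd_cyc evn addbA -tP addbT.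
  rewrite -[nat_of_ord (t x + 1)%R]/(val _) val_succ; case: ltnP => // le_n.
  have tx : (t x).+1 = n by apply/eqP; rewrite eqn_leq le_n andbT.
  by rewrite -oddS tx (negbTE evn).
(* A total map leaves no hole, so the jump move never applies. *)
- by move=> t p f _ /(_ ((t^-1)%g f)); rewrite permKV eqxx inE => /(_ isT).
- move=> t u tu; have -> : t = u by apply/permP => x; apply: tu; rewrite inE.
  by [].
Qed.

(* The two parities of the missing point are distinct J-classes of corank 1. *)
Lemma parity_submonoid c : ~~ odd n ->
  is_submonoid [set a in AOP n | [forall (h : 'I_n | odd h == c), pdom a != [set~ h]]].
Proof.
move=> evn; have /is_submonoidP[AOP1 AOPm] := AOP_submonoid n; apply/is_submonoidP; split.
  rewrite inE AOP1; apply/forall_inP => h _.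
  by rewrite -res1T pdom_res; apply/eqP => /setP/(_ h); rewrite !inE eqxx.
move=> a b /setIdP[aA /forall_inP na] /setIdP[bA /forall_inP nb].
apply/setIdP; split; first exact: AOPm.
apply/forall_inP => h hc; apply/eqP => abh.
have hab : [set~ h] \subset pdom a by rewrite -abh pdomM_sub.
(* Either the hole [h] is already that of [a], or [a] is total and [b] has the hole [s h], of the
   same parity. *)
have [ha|ha] := boolP (h \in pdom a); last first.
  have /negP[] := na _ hc; rewrite eqEsubset hab andbT; apply/subsetP => x xa.
  by rewrite in_setC1; apply: contraNneq ha => <-.
have /AOP_P[s [evs cys aE]] := aA; have aT : pdom a = setT.
  apply/setP => x; rewrite in_setT; have [->//|xh] := eqVneq x h.
  by apply: (subsetP hab); rewrite in_setC1.
rewrite aT in cys aE; have /negP[] : pdom b != [set~ s h].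
  by apply: nb; rewrite (total_parity evn evs cys).
apply/eqP/setP => y; have := congr1 (fun B : {set 'I_n} => (s^-1)%g y \in B) abh.
rewrite /= [in LHS]inE ppermM aE resE inE /= permKV in_setC1 => byE.
by rewrite in_setC1 inE byE -(inj_eq (@perm_inj _ s)) permKV.
Qed.

Lemma generates_hole (G : {set pperm n}) a (h : 'I_n) :
  ~~ odd n -> generates (AOP n) G -> a \in AOP n -> pdom a = [set~ h] ->
  exists b (k : 'I_n), [/\ b \in G, pdom b = [set~ k] & odd k = odd h].
Proof.
move=> evn gG aA ah.
have [|b bG] := generates_notin gG (parity_submonoid (odd h) evn) aA.
  by rewrite inE aA negb_forall; apply/existsP; exists h; rewrite ah !eqxx.
have bA : b \in AOP n by rewrite -(eqP gG) (subsetP (sub_gen_submonoid G)).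
rewrite inE bA => /forall_inPn[k /eqP kh]; rewrite negbK => /eqP bk.
by exists b, k.
Qed.

Lemma res_cycX_neq1 k : 0 < k < n -> res (cyc m ^+ k)%g setT != 1%g.
Proof.
move=> /andP[k0 kn]; apply/eqP => c1; have := resE (cyc m ^+ k)%g setT 0%R.
rewrite c1 pperm1E inE cycXE add0r => -[/esym/eqP].
by rewrite -[X in X == _]add0r -[0%R in X in _ == X]add0r (@eq_addn m 0%R k 0) // eqn0Ngt k0.
Qed.

Lemma setC1_neqT (h : 'I_n) : [set~ h] != setT.
Proof. by apply/eqP => /setP/(_ h); rewrite !inE eqxx. Qed.

Lemma rank_odd (G : {set pperm n}) : odd n -> generates (AOP n) G -> 2 <= #|G|.
Proof.
move=> oddn gG.
(* The witness [cyc m ^+ 2] is total and, as [2 < n], not the identity. *)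
have [|b bG bT] := generates_total gG cyc_sq_AOP (pdom_res _ _); first exact: res_cycX_neq1.
have [|d dG dT] := generates_partial gG (rho_sq_AOP 0%R); first by rewrite pdom_res setC1_neqT.
suff <- : #|[set b; d]| = 2 by apply: subset_leq_card; apply/subsetP => _ /set2P[] ->.
by rewrite cards2; case: eqP => // bd; rewrite -bd bT eqxx in dT.
Qed.

Lemma rho_AOP p : ~~ odd n -> res (rho p) [set~ p + 1]%R \in AOP n.
Proof. by move=> evn; rewrite res_AOP ?odd_rho //; apply: cyclic_on_rho. Qed.

Lemma rank_even (G : {set pperm n}) : ~~ odd n -> generates (AOP n) G -> 3 <= #|G|.
Proof.
move=> evn gG.
have [|b bG bT] := generates_total gG cyc_sq_AOP (pdom_res _ _); first exact: res_cycX_neq1.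
(* [rho (-1)] and [rho 0] have their holes at 0 and 1, of opposite parity, so the two generators
   found have different holes. *)
have [d [k [dG dk kE]]] := generates_hole evn gG (rho_AOP (-1)%R evn) (pdom_res _ _).
have [e [l [eG el lE]]] := generates_hole evn gG (rho_AOP 0%R evn) (pdom_res _ _).
have kl : k != l by apply: contraTneq isT => kl; move: kE lE; rewrite kl => ->; rewrite addNr add0r.
suff <- : #|[set b; d; e]| = 3.
  by apply: subset_leq_card; apply/subsetP => _ /setUP[/set2P[]|/set1P] ->.
apply: cards3; apply/eqP => E.
- by have := setC1_neqT k; rewrite -dk -E bT eqxx.
- by have := setC1_neqT l; rewrite -el -E bT eqxx.
- by have /setP/(_ k) := el; rewrite -E dk !in_setC1 eqxx (negbTE kl).
Qed.

End MinimalGeneration.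

Theorem theorem4p2 (n : nat) (n_ge3 : 3 <= n) :
  [/\ odd n ->
        min_generating (AOP n) [set g_cyc n; (g_last n ^+ 2)%g],
      ~~ odd n ->
        min_generating (AOP n) [set (g_cyc n ^+ 2)%g; g_first n; g_last n],
      odd n -> mrank (AOP n) = 2 &
      ~~ odd n -> mrank (AOP n) = 3].
Proof.
case: n n_ge3 => [|[|[|m]]] // _.
(* The listed generators have pairwise different domains, so the sets really have 2 and 3
   elements. *)
have card_odd : #|[set g_cyc m.+3; (g_last m.+3 ^+ 2)%g]| = 2.
  rewrite cards2 g_cyc_res (g_last_res (subr1_addr1 m)) res_rho_sq; case: eqP => // E.
  have := congr1 (@pdom _) E; rewrite !pdom_res => /esym/eqP.
  by rewrite (negbTE (setC1_neqT _)).
have p0E : (-1 + 1 = 0 :> 'I_m.+3)%R by rewrite addNr.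
have card_even : #|[set (g_cyc m.+3 ^+ 2)%g; g_first m.+3; g_last m.+3]| = 3.
  rewrite g_cyc_res (g_first_res p0E) (g_last_res (subr1_addr1 m)) res_cyc_sq.
  apply: cards3; apply/eqP => /(congr1 (@pdom _)); rewrite !pdom_res.
  - by apply/eqP; rewrite eq_sym setC1_neqT.
  - by apply/eqP; rewrite eq_sym setC1_neqT.
  - by move=> /setP/(_ 0%R); rewrite subr1_addr1 p0E !in_setC1 eqxx eq_sym oppr_eq0 oner_eq0.
have min_odd : odd m.+3 -> min_generating (AOP m.+3) [set g_cyc m.+3; (g_last m.+3 ^+ 2)%g].
  move=> oddn; split; first exact: generates_odd.
  by move=> B gB; rewrite card_odd rank_odd.
have min_even : ~~ odd m.+3 ->
    min_generating (AOP m.+3) [set (g_cyc m.+3 ^+ 2)%g; g_first m.+3; g_last m.+3].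
  move=> evn; split; first exact: generates_even.
  by move=> B gB; rewrite card_even rank_even.
split=> // [/min_odd|/min_even] /(mrank_min (AOP_submonoid _)) ->; first exact: card_odd.
exact: card_even.
Qed.
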